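(* Let $p\ge 7$ be a prime with $p\equiv 3\pmod 4$. Then, in $\mathbb Z_{(p)}[i]$, $$\mathbf G_p(p)\equiv -\frac{p^5}{12}(p-1)^2(p-2)(1-i)B_{p-3}\pmod{p^6}.$$ Moreover, $(1-i)p^5\mid \mathbf G_p(p)$ in $\mathbb Z[i]$. Furthermore $p$ does not divide the denominator of $B_{p-3}$ (so that the reduction of $B_{p-3}$ modulo $p$ is well defined), and $$v_p(\mathbf G_p(p))\ge 6\iff B_{p-3}\equiv 0\pmod p,$$ and equivalently $$v_p(\mathbf G_p(p))=5\iff B_{p-3}\not\equiv 0\pmod p.$$
   Context: Here $i^2=-1$. For an odd prime $p$ and $n\ge 0$, $\mathbf G_n(p)=\sum_{a=1}^{p-1}\sum_{b=1}^{p-1}(a+bi)^n\in\mathbb Z[i]$; thus $\mathbf G_p(p)$ is the case $n=p$. $B_n$ denotes the $n$-th Bernoulli number, $\frac{z}{e^z-1}=\sum_{n\ge0}B_n\frac{z^n}{n!}$ (so $B_1=-\tfrac12$). $\mathbb Z_{(p)}$ is the localization of $\mathbb Z$ at $(p)$, and $x\equiv y\pmod{p^k}$ in $\mathbb Z_{(p)}[i]$ means $x-y\in p^k\mathbb Z_{(p)}[i]$. For $x+yi\in\mathbb Z[i]$, $v_p(x+yi)=\min\{v_p(x),v_p(y)\}$, where $v_p$ on integers is the usual $p$-adic valuation ($v_p(0)=\infty$). *)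

(* Defs.v *)
From mathcomp Require Import all_boot all_order all_algebra.
From mathcomp Require Export complex.
From mathcomp Require Export constructive_ereal.

Set Implicit Arguments.
Unset Strict Implicit.
Unset Printing Implicit Defensive.

Import Order.TTheory GRing.Theory Num.Theory.
Local Open Scope ring_scope.

(* Formal power series over rat are given by their coefficient sequences. *)
Definition fps_mul (a b : nat -> rat) : nat -> rat :=
  fun n => \sum_(k < n.+1) a k * b (n - k)%N.

(* [:: b_(n-1); ...; b_0], where b is the reciprocal of a (if a_0 != 0):
   a_0 b_n = [n = 0] - \sum_(1 <= k <= n) a_k b_(n-k). *)
Fixpoint fps_inv_rev (a : nat -> rat) (n : nat) : seq rat :=
  if n is m.+1 then
    let s := fps_inv_rev a m in
    (((m == 0)%:R - \sum_(k < m) a k.+1 * s`_k) / a 0) :: s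
  else [::].

Definition fps_inv (a : nat -> rat) : nat -> rat :=
  fun n => head 0 (fps_inv_rev a n.+1).

Lemma nth_fps_inv_rev a n k :
  (k < n)%N -> (fps_inv_rev a n)`_k = fps_inv a (n - k.+1).
Proof.
elim: n k => // n IHn [|k] lt_kn; first by rewrite subSS subn0.
by rewrite subSS -IHn.
Qed.

Lemma fps_mulV a n : a 0 != 0 -> fps_mul a (fps_inv a) n = (n == 0)%:R.
Proof.
move=> a0; rewrite /fps_mul big_ord_recl subn0 {1}/fps_inv /=.
rewrite mulrC divfK //.
under eq_bigr => k _ do rewrite nth_fps_inv_rev //.
by rewrite addrNK.
Qed.

(* (e^z - 1) / z *)
Definition fps_expm1_div : nat -> rat := fun n => (n.+1`!)%:R^-1.

(* B_n / n! is the coefficient of z^n in z / (e^z - 1). *)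
Definition bernoulli (n : nat) : rat := n`!%:R * fps_inv fps_expm1_div n.

Lemma bernoulli_egf n :
  fps_mul fps_expm1_div (fun k => bernoulli k / k`!%:R) n = (n == 0)%:R.
Proof.
rewrite -(@fps_mulV fps_expm1_div) //; apply: eq_bigr => k _.
by rewrite /bernoulli mulrAC mulfV ?mul1r // pnatr_eq0 -lt0n fact_gt0.
Qed.

Definition integers : {pred rat} := [pred x | x \is a Num.int].

(* Z_(p): denq is the denominator in lowest terms. *)
Definition zlocal (p : nat) : {pred rat} :=
  [pred x | ~~ (p%:Z %| denq x)%Z].

(* S[i] inside Q(i) = rat[i]. *)
Definition adjoin_i (S : {pred rat}) : {pred rat[i]} :=
  [pred z | (complex.Re z \in S) && (complex.Im z \in S)].

(* Divisibility and congruence in a subring S of R. *)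
Definition dvd_in (R : pzRingType) (S : {pred R}) (d x : R) : Prop :=
  exists2 w, w \in S & x = d * w.

Definition eqmod_in (R : pzRingType) (S : {pred R}) (m x y : R) : Prop :=
  [/\ x \in S, y \in S & dvd_in S m (x - y)].

Definition gauss_sum (p n : nat) : rat[i] :=
  \sum_(1 <= a < p) \sum_(1 <= b < p) (a%:R +i* b%:R)%C ^+ n.

(* The p-adic valuation on Q; on integers denq is 1. *)
Definition vp (p : nat) (x : rat) : \bar int :=
  if x == 0 then +oo%E
  else ((logn p `|numq x|%N)%:Z - (logn p `|denq x|%N)%:Z)%:E.

Definition vpi (p : nat) (z : rat[i]) : \bar int :=
  Order.min (vp p (complex.Re z)) (vp p (complex.Im z)).

(* Main.v *)
Require Import Defs.
From HB Require Import structures.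
From mathcomp Require Import all_boot all_order all_algebra.
From mathcomp Require Import ring lra zify.

Import Order.TTheory GRing.Theory Num.Theory.
Local Open Scope ring_scope.

(** Write S_m for the sum of the a^m, 0 < a < p.  Since p = 3 mod 4, the
    binomial expansion of (a + b i)^p pairs the term of index 2k with the one
    of index p - 2k, and the pair contributes a multiple of 1 - i.  Hence the
    Gaussian sum is (1 - i) T with T the integer
      T = sum over 0 <= k <= h of (-1)^k C(p, 2k) S_(2k) S_(p-2k),
    where h = (p - 1) / 2 ([gauss_sumE]).  All claims are about T modulo p^6:
    the congruence T = - p^5 (p-1)^2 (p-2) B_(p-3) / 12 ([gauss_part_mod6])
    contains them, because B_(p-3) is p-integral and the other factors of the
    coefficient of p^5 are units of Z_(p).

    Faulhaber's formula writes S_m as the sum over k of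
    C(m, k) B_(m-k) p^(k+1) / (k+1).  The Bernoulli numbers of odd index > 1
    vanish and B_0, ..., B_(p-2) are p-integral, so S_m is p B_m modulo p^3
    for even m with 4 <= m < p, and m B_(m-1) p^2 / 2 modulo p^4 for odd m
    with 5 <= m < p; S_2 and S_3 have the same leading terms, but need a
    correction.  For 0 < k < h the binomial coefficient supplies one more
    factor p, and the term of index k is determined modulo p^6 by these
    approximations ([gauss_term_approx]).  The product of the leading terms is
    [lead_term], of order p^4; as k is replaced by h - k it changes sign,
    because h is odd, and so the leading terms cancel in total
    ([sum_lead_term]).

    What remains has order p^5 and comes from four places.  In the terms k = 0
    and k = h the contributions of p B_(p-1), which is not divisible by p,
    cancel exactly ([gauss_term_ends]).  In the terms k = 1 and k = h - 1,
    S_2 and S_3 also involve B_1, the only non-zero Bernoulli number of odd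
    index ([gauss_term1], [gauss_term_penultimate]).  Each of these gives a
    multiple of p^5 B_(p-3); modulo p^6 they add up to p^5 B_(p-3) times
    1/12 + 1/4 - 1/6 = 1/6, as stated. *)

(** * Bernoulli numbers and Faulhaber's formula *)

Lemma bernoulli_rec n :
  \sum_(j < n.+1) 'C(n.+1, j)%:R * bernoulli j = (n == 0)%:R.
Proof.
have := congr1 ( *%R n.+1`!%:R) (bernoulli_egf n).
rewrite /fps_mul mulr_sumr (reindex_inj rev_ord_inj) /=.
have -> : n.+1`!%:R * (n == 0)%:R = (n == 0)%:R :> rat.
  by case: n => [|n]; rewrite ?mulr0 // mulr1.
move=> <-; apply: eq_bigr => j _.
have le_jn : (j <= n)%N by rewrite -ltnS.
rewrite /fps_expm1_div subSS subKn // -subSn //.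
have := bin_fact (leqW le_jn) => /(congr1 (fun k => k%:R : rat)).
rewrite !natrM => <-.
have fn0 k : k`!%:R != 0 :> rat by rewrite pnatr_eq0 -lt0n fact_gt0.
by field; rewrite !fn0.
Qed.

(** The umbral functional, linear and sending X^n to B_n.  The recurrence of
    the Bernoulli numbers becomes the identity [umbral_shift1], from which
    both Faulhaber's formula and the vanishing of the odd Bernoulli numbers
    follow without manipulating double binomial sums. *)
Definition umbral (q : {poly rat}) : rat :=
  \sum_(i < size q) q`_i * bernoulli i.

Lemma umbral_wide n (q : {poly rat}) :
  (size q <= n)%N -> umbral q = \sum_(i < n) q`_i * bernoulli i.
Proof.
move=> le_qn; rewrite /umbral (big_ord_widen n (fun i => q`_i * bernoulli i)) //.
rewrite big_mkcond; apply: eq_bigr => i _.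
by case: ltnP => // /leq_sizeP-> //; rewrite mul0r.
Qed.

Lemma umbral_is_linear : scalar umbral.
Proof.
move=> c q r; pose n := maxn (size (c *: q + r)) (maxn (size q) (size r)).
rewrite !(@umbral_wide n) ?leq_max ?leqnn ?orbT // mulr_sumr -big_split /=.
by apply: eq_bigr => i _; rewrite coefD coefZ mulrDl mulrA.
Qed.

HB.instance Definition _ :=
  GRing.isLinear.Build rat {poly rat} rat *%R umbral umbral_is_linear.

Lemma umbralXn n : umbral 'X^n = bernoulli n.
Proof.
rewrite /umbral size_polyXn big_ord_recr /= coefXn eqxx mul1r big1 ?add0r // => i _.
by rewrite coefXn ltn_eqF ?mul0r.
Qed.

Lemma poly_monomial_ind (R : nzRingType) (P : {poly R} -> Prop) :
    (forall n, P 'X^n) -> (forall c q r, P q -> P r -> P (c *: q + r)) ->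
  forall q, P q.
Proof.
move=> PX Plin q; rewrite -[q]coefK poly_def.
have P0 : P 0 by have := Plin (-1) _ _ (PX 0) (PX 0); rewrite scaleN1r addNr.
by elim/big_rec: _ => // i r _ Pr; apply: Plin.
Qed.

Lemma umbral_shift1 (q : {poly rat}) :
  umbral (q \Po ('X + 1)) - umbral q = q^`().[0].
Proof.
elim/poly_monomial_ind: q => [n|c q r hq hr]; last first.
  by rewrite comp_polyD comp_polyZ !linearP /= hornerD hornerZ -hq -hr; ring.
rewrite derivXn hornerMn hornerXn comp_Xn_poly exprD1n linear_sum /=.
rewrite big_ord_recr /= binn mulr1n addrK.
under eq_bigr => j _ do rewrite raddfMn /= umbralXn -mulr_natl.
case: n => [|n]; first by rewrite big_ord0 mulr0n.
by rewrite bernoulli_rec expr0n; case: n => // n; rewrite mul0rn.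
Qed.

(** This functional vanishes: umbrally, - B and B + 1 have the same moments,
    which is the symmetry B_n(1 - x) = (-1)^n B_n(x) of the Bernoulli
    polynomials at x = 0. *)
Definition reflection_defect (q : {poly rat}) : rat :=
  umbral (q \Po - 'X) - umbral (q \Po ('X + 1)).

Lemma reflection_defect_is_scalar : scalar reflection_defect.
Proof.
move=> c q r.
by rewrite /reflection_defect !comp_polyD !comp_polyZ !linearP /=; ring.
Qed.

HB.instance Definition _ :=
  GRing.isLinear.Build rat {poly rat} rat *%R reflection_defect
    reflection_defect_is_scalar.

(** By [umbral_shift1], translating the argument changes each of the two terms
    of the defect by the derivative of q at 1. *)
Lemma reflection_defect_shift (q : {poly rat}) :
  reflection_defect (q \Po ('X + 1)) = reflection_defect q.
Proof.
rewrite /reflection_defect.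
have comp_polyN (r s : {poly rat}) : - r \Po s = - (r \Po s).
  exact: (raddfN (comp_poly s)).
have := umbral_shift1 (q \Po ('X + 1)).
have := umbral_shift1 (q \Po (1 - 'X)).
rewrite -!comp_polyA.
rewrite !(comp_polyD, comp_polyB, comp_polyN, comp_polyX, comp_polyC, rmorph1).
rewrite opprD addrCA subrr addr0 !deriv_comp !hornerM !horner_comp !derivE.
rewrite !hornerE /= (addrC (- 'X) 1); lra.
Qed.

(** A translation-invariant functional is zero: applied to X^(n+1), invariance
    says that the sum of C(n+1, i) L(X^i) for i <= n vanishes, which
    determines L(X^n) from the lower monomials. *)
Lemma reflection_defectXn n : reflection_defect 'X^n = 0.
Proof.
elim/ltn_ind: n => n IHn.
have := reflection_defect_shift 'X^(n.+1).
rewrite comp_Xn_poly exprD1n linear_sum /= big_ord_recr /= binn mulr1n.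
move/eqP; rewrite addrC -subr_eq0 addrAC subrr add0r.
rewrite big_ord_recr /= big1 => [|i _].
  by rewrite add0r raddfMn /= binSn mulrn_eq0 => /eqP.
by rewrite raddfMn /= IHn ?mul0rn.
Qed.

Lemma bernoulli_odd_eq0 n : odd n -> (1 < n)%N -> bernoulli n = 0.
Proof.
move=> n_odd n_gt1.
have := reflection_defectXn n; rewrite /reflection_defect.
have := umbral_shift1 'X^n.
rewrite derivXn hornerMn hornerXn expr0n -subn1 subn_eq0 leqNgt n_gt1 mul0rn.
rewrite !comp_Xn_poly exprNn -signr_odd n_odd expr1 mulN1r linearN /= umbralXn.
lra.
Qed.

(** Faulhaber's formula.  By [umbral_shift1], (m+1) a^m is the increment at a
    of the map sending a to umbral ((X + a)^(m+1)), so the sum telescopes; the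
    right-hand side is the binomial expansion at a = n. *)
Lemma powsum_bernoulli n m :
  \sum_(0 <= a < n) a%:R ^+ m =
  \sum_(k < m.+1) 'C(m, k)%:R * bernoulli (m - k) * n%:R ^+ k.+1 / k.+1%:R :> rat.
Proof.
have step a :
    umbral (('X + a.+1%:R%:P) ^+ m.+1) - umbral (('X + a%:R%:P) ^+ m.+1) =
    m.+1%:R * a%:R ^+ m.
  have := umbral_shift1 (('X + a%:R%:P) ^+ m.+1).
  rewrite rmorphXn /= comp_polyD comp_polyX comp_polyC -addrA.
  rewrite -polyC1 -polyCD nat1r => ->.
  rewrite deriv_exp derivD derivX derivC addr0 mul1r hornerMn !hornerE /=.
  by rewrite mulr_natl.
have nz k : k.+1%:R != 0 :> rat by rewrite pnatr_eq0.
apply: (mulfI (nz m)); rewrite mulr_sumr.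
under eq_bigr => a _ do rewrite -step.
rewrite telescope_sumr // addr0 exprDn linear_sum /=.
rewrite big_ord_recl /= bin0 subn0 expr0 mulr1 mulr1n addrC addKr mulr_sumr.
apply: eq_bigr => k _.
rewrite raddfMn /= /bump leq0n add1n subSS.
rewrite mulrC -rmorphXn /= mul_polyC linearZ /= umbralXn.
have := mul_bin_diag m.+1 k => /(congr1 (fun k => k%:R : rat)) /=.
rewrite !natrM => /esym/(canRL (mulKf (nz k))) h.
rewrite -[LHS]mulr_natr h.
by field; rewrite nat1r nz.
Qed.

(** * The ring of p-integral rationals and the powers of its maximal ideal *)

(** The lowest-terms denominator is awkward under ring operations; any
    denominator prime to p will do. *)
Lemma zlocalP p x : prime p ->
  reflect (exists2 d : int, ~~ (p%:Z %| d)%Z & x * d%:~R \is a Num.int)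
          (x \in zlocal p).
Proof.
move=> p_prime; apply: (iffP idP) => [xZp | [d pNd /intrP[n xd]]].
  exists (denq x) => //; rewrite -{1}[x]divq_num_den divfK ?intr_int //.
  by rewrite intr_eq0 denq_eq0.
rewrite inE; apply: contra pNd => p_den.
have : (numq x * d)%:~R = (n * denq x)%:~R :> rat.
  by rewrite !intrM -xd numqE mulrAC.
move/intr_inj => nd.
have : (p%:Z %| numq x * d)%Z by rewrite nd dvdz_mull.
rewrite !dvdzE abszM /= Euclid_dvdM // => /orP[p_num|//].
have : (p %| gcdn `|numq x| `|denq x|)%N by rewrite dvdn_gcd p_num.
by rewrite (eqP (coprime_num_den x)) dvdn1 => /eqP p1; rewrite p1 in p_prime.
Qed.

Lemma zlocal_nat p n : prime p -> n%:R \in zlocal p.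
Proof.
move=> p_prime; rewrite inE pmulrn denq_int dvdz1 /=.
by rewrite gtn_eqF ?prime_gt1.
Qed.

Lemma zlocalD p x y : prime p ->
  x \in zlocal p -> y \in zlocal p -> x + y \in zlocal p.
Proof.
move=> p_prime /(zlocalP _ _ p_prime)[d pNd xd] /(zlocalP _ _ p_prime)[e pNe ye].
apply/zlocalP => //; exists (d * e).
  by rewrite dvdzE abszM Euclid_dvdM // negb_or pNd.
rewrite intrM mulrDl mulrA (mulrC d%:~R) (mulrA y).
by rewrite rpredD // rpredM ?intr_int.
Qed.

Lemma zlocalM p x y : prime p ->
  x \in zlocal p -> y \in zlocal p -> x * y \in zlocal p.
Proof.
move=> p_prime /(zlocalP _ _ p_prime)[d pNd xd] /(zlocalP _ _ p_prime)[e pNe ye].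
apply/zlocalP => //; exists (d * e).
  by rewrite dvdzE abszM Euclid_dvdM // negb_or pNd.
by rewrite intrM mulrACA rpredM.
Qed.

Lemma zlocalN p x : x \in zlocal p -> - x \in zlocal p.
Proof. by rewrite !inE denqN. Qed.

Lemma zlocal_natV p n : prime p -> ~~ (p %| n)%N -> n%:R^-1 \in zlocal p.
Proof.
move=> p_prime pNn; apply/zlocalP => //; exists n%:Z => //.
by rewrite -pmulrn mulVf // pnatr_eq0; apply: contra pNn => /eqP->.
Qed.

Lemma zlocal_sum p (I : Type) (r : seq I) (P : pred I) (F : I -> rat) :
    prime p -> (forall i, P i -> F i \in zlocal p) ->
  \sum_(i <- r | P i) F i \in zlocal p.
Proof.
move=> p_prime FZ; elim/big_ind: _ => // [|x y]; first exact: (zlocal_nat _ 0).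
exact: zlocalD.
Qed.

(** The fractional ideal p^k Z_(p), used to express congruences modulo p^k. *)
Definition zideal p k : {pred rat} := [pred x | x / p%:R ^+ k \in zlocal p].

Lemma zidealE p k x : (x \in zideal p k) = (x / p%:R ^+ k \in zlocal p).
Proof. by []. Qed.

Section Ideal.
Variables (p : nat) (p_prime : prime p).

Let p_neq0 : p%:R != 0 :> rat.
Proof. by rewrite pnatr_eq0 -lt0n prime_gt0. Qed.

Let pX_neq0 k : p%:R ^+ k != 0 :> rat.
Proof. by rewrite expf_neq0. Qed.

Lemma zideal0E : zideal p 0 =i zlocal p.
Proof. by move=> x; rewrite zidealE expr0 divr1. Qed.

Lemma zidealD k x y :
  x \in zideal p k -> y \in zideal p k -> x + y \in zideal p k.
Proof. by rewrite !zidealE mulrDl => ? ?; apply: zlocalD. Qed.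

Lemma zidealN k x : x \in zideal p k -> - x \in zideal p k.
Proof. by rewrite zidealE => /zlocalN; rewrite -mulNr. Qed.

Lemma zidealM k l x y :
  x \in zideal p k -> y \in zideal p l -> x * y \in zideal p (k + l).
Proof.
by rewrite !(zidealE, exprD, invfM) => xk yl; rewrite mulrACA; apply: zlocalM.
Qed.

Lemma zidealMl k x y :
  x \in zlocal p -> y \in zideal p k -> x * y \in zideal p k.
Proof. by rewrite -zideal0E; apply: zidealM. Qed.

Lemma zidealMr k x y :
  x \in zideal p k -> y \in zlocal p -> x * y \in zideal p k.
Proof. by move=> xI yZ; rewrite mulrC zidealMl. Qed.

Lemma zidealX k : p%:R ^+ k \in zideal p k.
Proof. by rewrite zidealE divff // (zlocal_nat _ 1). Qed.

Lemma zideal_le k l x : (l <= k)%N -> x \in zideal p k -> x \in zideal p l.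
Proof.
move=> le_lk; rewrite !zidealE => xk.
have -> : x / p%:R ^+ l = x / p%:R ^+ k * (p ^ (k - l))%:R.
  rewrite natrX -{1}(subnKC le_lk) exprD; field.
  by rewrite !pX_neq0.
by rewrite zlocalM ?zlocal_nat.
Qed.

Lemma zideal_sum k (I : eqType) (r : seq I) (F : I -> rat) :
  (forall i, i \in r -> F i \in zideal p k) -> \sum_(i <- r) F i \in zideal p k.
Proof.
move=> FI; rewrite big_seq; elim/big_ind: _ => // [|x y]; last exact: zidealD.
by rewrite zidealE mul0r (zlocal_nat _ 0).
Qed.

End Ideal.
Arguments zidealM {p} _ {k l x y}.

(** Relative precision is preserved by products: the two factors are known to
    the same number k of p-adic digits beyond their orders i and j. *)
Lemma zideal_approx_mul p i j k (a b x y : rat) : prime p ->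
  a \in zideal p i -> b \in zideal p j ->
  x - a \in zideal p (i + k) -> y - b \in zideal p (j + k) ->
  x * y - a * b \in zideal p (i + j + k).
Proof.
move=> p_prime aI bI xa yb.
have -> : x * y - a * b = (x - a) * b + a * (y - b) + (x - a) * (y - b) by ring.
apply: zidealD => //; first apply: zidealD => //.
- by have := zidealM p_prime xa bI; rewrite addnAC.
- by have := zidealM p_prime aI yb; rewrite addnA.
apply: zideal_le (zidealM p_prime xa yb) => //; lia.
Qed.

Lemma natr_zideal p k n : prime p -> (p ^ k %| n)%N -> n%:R \in zideal p k.
Proof.
move=> p_prime /dvdnP[c ->]; rewrite natrM natrX.
by apply: zidealMl; rewrite ?zlocal_nat ?zidealX.
Qed.

Lemma bernoulli0 : bernoulli 0 = 1.
Proof.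
by have := bernoulli_rec 0; rewrite big_ord_recl big_ord0 bin0 mul1r addr0.
Qed.

Lemma bernoulli1 : bernoulli 1 = - 2%:R^-1.
Proof.
have := bernoulli_rec 1.
rewrite !big_ord_recl big_ord0 /= bernoulli0 bin0 bin1; lra.
Qed.

(** The recurrence only divides by n + 1 < p. *)
Lemma bernoulli_zlocal p n : prime p -> (n <= p - 2)%N ->
  bernoulli n \in zlocal p.
Proof.
move=> p_prime; have p_gt1 := prime_gt1 p_prime.
elim/ltn_ind: n => n IHn le_n.
have := bernoulli_rec n; rewrite big_ord_recr /= binSn.
move/(canRL (addKr _)).
have nz : n.+1%:R != 0 :> rat by rewrite pnatr_eq0.
move/(canRL (mulKf nz)) => ->.
apply: zlocalM => //.
  by apply: zlocal_natV => //; rewrite gtnNdvd //; lia.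
apply: zlocalD => //; last exact: zlocal_nat.
apply: zlocalN; apply: zlocal_sum => // j _.
apply: zlocalM => //; first exact: zlocal_nat.
by apply: IHn => //; have := ltn_ord j; lia.
Qed.

(** * Power sums modulo powers of p *)

Definition powsum (p m : nat) : rat := \sum_(1 <= a < p) a%:R ^+ m.

Definition faulhaber_term (p m k : nat) : rat :=
  'C(m, k)%:R * bernoulli (m - k) * p%:R ^+ k.+1 / k.+1%:R.

Lemma powsumE p m : (0 < p)%N -> (0 < m)%N ->
  powsum p m = \sum_(k < m.+1) faulhaber_term p m k.
Proof.
by move=> p0 m0; rewrite -powsum_bernoulli big_ltn // expr0n gtn_eqF // add0r.
Qed.

Lemma powsum0 p : (0 < p)%N -> powsum p 0 = p%:R - 1.
Proof.
move=> p0; rewrite /powsum (eq_bigr _ (fun _ _ => expr0 _)).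
by rewrite sumr_const_nat natrB.
Qed.

Lemma powsum1 p : (0 < p)%N -> powsum p 1 = p%:R * (p%:R - 1) / 2%:R.
Proof.
move=> p0; rewrite powsumE // !big_ord_recr big_ord0 /faulhaber_term /=.
by rewrite bin0 binn bernoulli0 bernoulli1; field.
Qed.

(** The denominator k + 1 costs a factor p only for k + 1 = p, and there
    p^p / p is still divisible by p^(p-1), which suffices as r < p. *)
Lemma faulhaber_term_zideal p m k r : prime p -> (k <= m <= p)%N ->
  (m - k <= p - 2)%N -> (r <= k.+1)%N -> (r < p)%N ->
  faulhaber_term p m k \in zideal p r.
Proof.
move=> p_prime /andP[le_km le_mp] small le_rk lt_rp.
have p_gt1 := prime_gt1 p_prime.
rewrite /faulhaber_term -mulrA; apply: zidealMl => //.
  by apply: zlocalM; rewrite ?zlocal_nat ?bernoulli_zlocal.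
have [p_dvd | pNdvd] := boolP (p %| k.+1)%N; last first.
  apply: zidealMr => //; last exact: zlocal_natV.
  by apply: zideal_le (zidealX _ p_prime _).
have -> : k.+1 = p.
  by case/dvdnP: p_dvd => [[|[|c]]]; rewrite ?mul1n // !mulSn; lia.
have -> : p%:R ^+ p / p%:R = p%:R ^+ p.-1 :> rat.
  rewrite -{2}(prednK (ltnW p_gt1)) exprSr mulfK //.
  by rewrite pnatr_eq0 -lt0n ltnW.
by apply: zideal_le (zidealX _ p_prime _) => //; lia.
Qed.

Lemma powsum_trunc p m r : prime p -> (0 < m)%N -> (r <= m <= p)%N ->
    (m - r <= p - 2)%N -> (r.+1 < p)%N ->
  powsum p m - \sum_(k < r) faulhaber_term p m k \in zideal p r.+1.
Proof.
move=> p_prime m0 /andP[le_rm le_mp] small lt_rp.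
rewrite powsumE ?(prime_gt0 p_prime) //.
rewrite -(big_mkord xpredT) (big_cat_nat (n := r)) //=; last exact: leqW.
rewrite big_mkord addrAC subrr add0r; apply: zideal_sum => // k.
rewrite mem_index_iota => /andP[le_rk lt_km].
by apply: faulhaber_term_zideal => //; lia.
Qed.

Lemma natr_bin2 n : 'C(n, 2)%:R = n%:R * (n%:R - 1) / 2%:R :> rat.
Proof.
have := mul_bin_left n 1 => /(congr1 (fun k => k%:R : rat)).
rewrite !natrM bin1.
case: n => [|n]; first by rewrite bin0n; lra.
rewrite subSS subn0 => h; rewrite -natr1; lra.
Qed.

Lemma natr_bin3 n : 'C(n, 3)%:R = n%:R * (n%:R - 1) * (n%:R - 2%:R) / 6%:R :> rat.
Proof.
have := mul_bin_left n 2 => /(congr1 (fun k => k%:R : rat)).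
rewrite !natrM natr_bin2.
have [n_lt2 | n_ge2] := ltnP n 2.
  by case: n n_lt2 => [|[|//]] _ _; rewrite bin_small //; lra.
have three_neq0 : 3%:R != 0 :> rat by [].
rewrite natrB // => h; apply: (mulfI three_neq0); rewrite h.
by field.
Qed.

Lemma powsum_mod3 p m : prime p -> (3 < p)%N -> (2 <= m <= p)%N ->
  powsum p m - (p%:R * bernoulli m + m%:R * bernoulli m.-1 * p%:R ^+ 2 / 2%:R)
    \in zideal p 3.
Proof.
move=> p_prime p_gt3 /andP[m_ge2 le_mp].
have := @powsum_trunc p m 2 p_prime; rewrite !big_ord_recr big_ord0 /=.
rewrite /faulhaber_term add0r bin0 bin1 mul1r subn0 subn1 expr1 divr1.
by rewrite (mulrC (bernoulli m)); apply; lia.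
Qed.

Lemma powsum_mod4 p m : prime p -> (4 < p)%N -> (3 <= m <= p)%N ->
  powsum p m - (p%:R * bernoulli m + m%:R * bernoulli m.-1 * p%:R ^+ 2 / 2%:R
                + 'C(m, 2)%:R * bernoulli (m - 2) * p%:R ^+ 3 / 3%:R)
    \in zideal p 4.
Proof.
move=> p_prime p_gt3 /andP[m_ge2 le_mp].
have := @powsum_trunc p m 3 p_prime; rewrite !big_ord_recr big_ord0 /=.
rewrite /faulhaber_term add0r bin0 bin1 mul1r subn0 subn1 expr1 divr1.
by rewrite (mulrC (bernoulli m)); apply; lia.
Qed.

(** B_(p-1) is not p-integral, so its term has order p^2 only; it is kept
    exactly, to be cancelled later. *)
Lemma powsum_p_mod6 p : prime p -> (6 < p)%N ->
  powsum p p - (bernoulli (p - 1) * p%:R ^+ 3 / 2%:R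
                + 'C(p, 3)%:R * bernoulli (p - 3) * p%:R ^+ 4 / 4%:R)
    \in zideal p 6.
Proof.
move=> p_prime p_gt6.
have p_odd : odd p by case: (even_prime p_prime) => // p2; rewrite p2 in p_gt6.
have := @powsum_trunc p p 5 p_prime; rewrite !big_ord_recr big_ord0 /=.
rewrite /faulhaber_term add0r bin0 bin1 mul1r subn0 expr1 divr1.
rewrite (bernoulli_odd_eq0 p) ?(bernoulli_odd_eq0 (p - 2)); try lia.
rewrite (bernoulli_odd_eq0 (p - 4)); [|lia|lia].
rewrite !(mulr0, mul0r, add0r, addr0).
have -> : p%:R * bernoulli (p - 1) * p%:R ^+ 2 / 2%:R
    = bernoulli (p - 1) * p%:R ^+ 3 / 2%:R :> rat.
  by field.
by apply; lia.
Qed.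

Lemma powsum_even p m : prime p -> (3 < p)%N -> ~~ odd m -> (4 <= m <= p)%N ->
  powsum p m - p%:R * bernoulli m \in zideal p 3.
Proof.
move=> p_prime p_gt3 m_even m_bounds.
have := powsum_mod3 p m p_prime p_gt3.
rewrite (bernoulli_odd_eq0 m.-1); [|lia|lia].
by rewrite !(mulr0, mul0r, addr0); apply; lia.
Qed.

Lemma powsum_odd p m : prime p -> (4 < p)%N -> odd m -> (5 <= m <= p)%N ->
  powsum p m - m%:R * bernoulli m.-1 * p%:R ^+ 2 / 2%:R \in zideal p 4.
Proof.
move=> p_prime p_gt4 m_odd m_bounds.
have := powsum_mod4 p m p_prime p_gt4.
rewrite (bernoulli_odd_eq0 m) ?(bernoulli_odd_eq0 (m - 2)); [|lia|lia|lia|lia].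
by rewrite !(mulr0, mul0r, addr0, add0r); apply; lia.
Qed.

(** * Expansion of the real part modulo the sixth power of p *)

(** The product of the leading terms p B_(2k) and (p-2k) B_(p-2k-1) p^2 / 2 of
    the two power sums, with its sign and binomial coefficient. *)
Definition lead_term (p k : nat) : rat :=
  (-1) ^+ k * 'C(p, k.*2)%:R * (p%:R * bernoulli k.*2
    * ((p - k.*2)%:R * bernoulli (p - k.*2).-1 * p%:R ^+ 2 / 2%:R)).

(** Both C(p, 2k) (p - 2k) = p C(p-1, 2k) and B_(2k) B_(p-1-2k) are invariant
    under 2k -> p - 1 - 2k, whereas the sign changes since (p-1)/2 is odd. *)
Lemma lead_term_reflect p k : odd p./2 -> odd p -> (0 < k < p./2)%N ->
  lead_term p (p./2 - k) = - lead_term p k.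
Proof.
move=> h_odd p_odd /andP[k_gt0 lt_kh].
have pE : p = p./2.*2.+1 by rewrite -[LHS]odd_double_half p_odd.
have bin_sym : 'C(p, (p./2 - k).*2)%:R * (p - (p./2 - k).*2)%:R
   = 'C(p, k.*2)%:R * (p - k.*2)%:R :> rat.
  rewrite -!natrM ![('C(_, _) * _)%N]mulnC -!mul_bin_down; congr (p * _)%:R.
  by rewrite -bin_sub; [congr 'C(_, _); lia | lia].
have idx1 : (p./2 - k).*2 = (p - k.*2).-1 by lia.
have idx2 : (p - (p./2 - k).*2).-1 = k.*2 by lia.
have sgn : (-1) ^+ (p./2 - k) = - (-1) ^+ k :> rat.
  by rewrite -signr_odd oddB ?h_odd 1?ltnW // signrN signr_odd.
have -> : lead_term p (p./2 - k) =
  (-1) ^+ (p./2 - k) * ('C(p, (p./2 - k).*2)%:R * (p - (p./2 - k).*2)%:R)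
   * bernoulli (p./2 - k).*2 * bernoulli (p - (p./2 - k).*2).-1
   * p%:R ^+ 3 / 2%:R.
  by rewrite /lead_term; field.
rewrite bin_sym idx2 idx1 sgn /lead_term.
by field.
Qed.

Lemma sum_lead_term p : odd p./2 -> odd p ->
  \sum_(1 <= k < p./2) lead_term p k = 0.
Proof.
move=> h_odd p_odd; set s := LHS.
have : s = - s.
  rewrite {1}/s big_nat_rev -sumrN; apply: eq_big_nat => k /= kh.
  by rewrite add1n subSS lead_term_reflect.
lra.
Qed.

Lemma prime_ndvd24 p : prime p -> (3 < p)%N -> ~~ (p %| 24)%N.
Proof.
move=> p_prime p_gt3; rewrite -[24%N]/(2 ^ 3 * 3)%N.
by rewrite Euclid_dvdM // Euclid_dvdX // !gtnNdvd // ltnW.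
Qed.

(** The contribution to the real part of the binomial terms of index 2k and
    p - 2k. *)
Definition gauss_term (p k : nat) : rat :=
  (-1) ^+ k * 'C(p, k.*2)%:R * powsum p k.*2 * powsum p (p - k.*2).

Section Expansion.
Variable p : nat.
Hypotheses (p_prime : prime p) (p_ge7 : (7 <= p)%N) (p_odd : odd p).

Let p2Z : 2%:R^-1 \in zlocal p.
Proof. by apply: zlocal_natV => //; rewrite gtnNdvd //; lia. Qed.

Let pI : p%:R \in zideal p 1. Proof. exact: (zidealX _ p_prime 1). Qed.

Lemma bin_zideal k : (0 < k < p)%N -> 'C(p, k)%:R \in zideal p 1.
Proof. by move=> kp; apply: natr_zideal => //; rewrite expn1 prime_dvd_bin. Qed.

Lemma sign_zlocal k : (-1) ^+ k \in zlocal p.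
Proof.
have Z1 : 1 \in zlocal p by exact: (zlocal_nat _ 1).
by rewrite -signr_odd; case: odd; first exact: zlocalN.
Qed.

(** The prime p divides the binomial coefficient, so the product of the power
    sums matters modulo p^5 only; since they are divisible by p and by p^2, it
    suffices to know the first modulo p^3 and the second modulo p^4. *)
Lemma gauss_term_approx k a b : (0 < k.*2 < p)%N ->
    a \in zideal p 1 -> b \in zideal p 2 ->
    powsum p k.*2 - a \in zideal p 3 -> powsum p (p - k.*2) - b \in zideal p 4 ->
  gauss_term p k - (-1) ^+ k * 'C(p, k.*2)%:R * (a * b) \in zideal p 6.
Proof.
move=> kp aI bI Sa Sb; rewrite /gauss_term -!mulrA -!mulrBr.
apply: zidealMl => //; first exact: sign_zlocal.
apply: (@zidealM p p_prime 1 5) => //; first by apply: bin_zideal.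
exact: (@zideal_approx_mul p 1 2 2).
Qed.

Let even_lead_zideal k : (k <= p - 2)%N -> p%:R * bernoulli k \in zideal p 1.
Proof. by move=> le_k; apply: zidealMr; rewrite ?bernoulli_zlocal. Qed.

Let odd_lead_zideal c k : (k <= p - 2)%N ->
  c%:R * bernoulli k * p%:R ^+ 2 / 2%:R \in zideal p 2.
Proof.
move=> le_k; apply: zidealMr => //; apply: zidealMl => //; last exact: zidealX.
by apply: zlocalM; rewrite ?zlocal_nat ?bernoulli_zlocal.
Qed.

Lemma gauss_term_middle k : (2 <= k)%N -> (k.*2 + 5 <= p)%N ->
  gauss_term p k - lead_term p k \in zideal p 6.
Proof.
move=> k_ge2 k_le; apply: gauss_term_approx; first lia.
- by apply: even_lead_zideal; lia.
- by apply: odd_lead_zideal; lia.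
- by apply: powsum_even => //; lia.
- by apply: powsum_odd => //; lia.
Qed.

(** S_2 is p B_2 + 2 B_1 p^2 / 2 modulo p^3: the term in B_1 = -1/2 is the
    source of the correction. *)
Lemma gauss_term1 :
  gauss_term p 1 - lead_term p 1
    - p%:R ^+ 5 * (p%:R - 1) * (p%:R - 2%:R) / 8%:R * bernoulli (p - 3)
  \in zideal p 6.
Proof.
pose a : rat := p%:R * bernoulli 2 - p%:R ^+ 2 / 2%:R.
pose b : rat := (p - 2)%:R * bernoulli (p - 2).-1 * p%:R ^+ 2 / 2%:R.
rewrite -addrA -opprD; have := gauss_term_approx 1 a b.
have -> : (-1) ^+ 1 * 'C(p, 1.*2)%:R * (a * b) = lead_term p 1 +
    p%:R ^+ 5 * (p%:R - 1) * (p%:R - 2%:R) / 8%:R * bernoulli (p - 3).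
  rewrite /lead_term /a /b -![1.*2]/2%N natr_bin2.
  have -> : (p - 2).-1 = (p - 3)%N by lia.
  by rewrite natrB; [field | lia].
apply; first lia.
- apply: zidealD; rewrite ?even_lead_zideal //; first lia.
  apply: zidealN; apply: zidealMr => //.
  by apply: zideal_le (zidealX _ p_prime 2).
- by apply: odd_lead_zideal; lia.
- have := powsum_mod3 p 2 p_prime; rewrite /= bernoulli1.
  have -> : p%:R * bernoulli 2 + 2%:R * - 2%:R^-1 * p%:R ^+ 2 / 2%:R = a.
    by rewrite /a; field.
  by apply; lia.
- by apply: powsum_odd => //; lia.
Qed.

(** Here S_3 = S_(p-2k), and C(3, 2) B_1 p^3 / 3 = - p^3 / 2 is not negligible
    modulo p^4. *)
Lemma gauss_term_penultimate : odd p./2 ->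
  gauss_term p p./2.-1 - lead_term p p./2.-1
    + p%:R ^+ 5 * (p%:R - 1) * (p%:R - 2%:R) / 12%:R * bernoulli (p - 3)
  \in zideal p 6.
Proof.
move=> h_odd; have kE : (p./2.-1).*2 = (p - 3)%N by lia.
pose a : rat := p%:R * bernoulli (p - 3).
pose b : rat := 3%:R * bernoulli 2 * p%:R ^+ 2 / 2%:R - p%:R ^+ 3 / 2%:R.
have sgn : (-1) ^+ p./2.-1 = 1 :> rat.
  by rewrite -signr_odd (_ : odd _ = false) //; lia.
set c := _ * _ * bernoulli _; rewrite -addrA -[X in _ + X]opprK opprD opprK.
have := gauss_term_approx p./2.-1 a b.
rewrite kE subKn; last lia.
have -> : (-1) ^+ p./2.-1 * 'C(p, p - 3)%:R * (a * b) = lead_term p p./2.-1 - c.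
  rewrite /c /lead_term kE sgn subKn; last lia.
  rewrite bin_sub; last lia.
  by rewrite /a /b natr_bin3 /=; field.
apply; first lia.
- by apply: even_lead_zideal; lia.
- apply: zidealD; rewrite ?odd_lead_zideal //; first lia.
  apply: zidealN; apply: zidealMr => //.
  by apply: zideal_le (zidealX _ p_prime 3).
- by apply: powsum_even => //; lia.
- have := powsum_mod4 p 3 p_prime; rewrite /= bernoulli1 (bernoulli_odd_eq0 3) //.
  have -> : p%:R * 0 + 3%:R * bernoulli 2 * p%:R ^+ 2 / 2%:R
      + 'C(3, 2)%:R * - 2%:R^-1 * p%:R ^+ 3 / 3%:R = b.
    by rewrite (_ : 'C(3, 2) = 3%N) // /b; field.
  by apply; lia.
Qed.

(** The term k = 0 is (p - 1) S_p and the term k = (p-1)/2 is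
    - p S_(p-1) S_1 with S_1 = p (p - 1) / 2; the parts p^3 (p-1) B_(p-1) / 2
    of both cancel. *)
Lemma gauss_term_ends : odd p./2 ->
  gauss_term p 0 + gauss_term p p./2
    + p%:R ^+ 5 * (p%:R - 1) ^+ 2 * (p%:R - 2%:R) / 24%:R * bernoulli (p - 3)
  \in zideal p 6.
Proof.
move=> h_odd; have hE : (p./2).*2 = (p - 1)%N by lia.
have p_gt0 : (0 < p)%N by lia.
rewrite /gauss_term hE -(signr_odd _ p./2) h_odd subKn // bin_sub // bin1 bin0.
rewrite subn0 powsum0 // powsum1 // expr0 expr1.
have := powsum_mod4 p (p - 1) p_prime.
rewrite (_ : (p - 1).-1 = p - 2)%N 1?(_ : (p - 1 - 2) = p - 3)%N; try lia.
rewrite (bernoulli_odd_eq0 (p - 2)); [|lia|lia].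
rewrite natr_bin2 natrB // !(mulr0, mul0r, addr0) => Spred.
have Sp := powsum_p_mod6 p p_prime; rewrite natr_bin3 in Sp.
set x := powsum p (p - 1) - _ in Spred; set y := powsum p p - _ in Sp.
have -> : 1 * 1 * (p%:R - 1) * powsum p p
    + -1 * p%:R * powsum p (p - 1) * (p%:R * (p%:R - 1) / 2%:R)
    + p%:R ^+ 5 * (p%:R - 1) ^+ 2 * (p%:R - 2%:R) / 24%:R * bernoulli (p - 3)
  = (p%:R - 1) * y - (p%:R - 1) / 2%:R * (p%:R ^+ 2 * x).
  by rewrite /x /y; field.
have pred_Z : p%:R - 1 \in zlocal p.
  by have := zlocal_nat p (p - 1) p_prime; rewrite natrB.
apply: zidealD => //; first by apply: zidealMl => //; apply: Sp; lia.
apply: zidealN; apply: zidealMl; rewrite ?zlocalM //.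
by apply: (@zidealM p p_prime 2 4); rewrite ?zidealX //; apply: Spred; lia.
Qed.

Definition gauss_part : rat := \sum_(k < p./2.+1) gauss_term p k.

(** With c = p^5 (p-1) (p-2) B_(p-3), the four exceptional terms add up to
    c (- (p-1)/24 + 1/8 - 1/12) = - c (p-2) / 24, which differs from
    - c (p-1) / 12 by the multiple c p / 24 of p^6. *)
Lemma gauss_part_mod6 : odd p./2 ->
  gauss_part
    + p%:R ^+ 5 * (p%:R - 1) ^+ 2 * (p%:R - 2%:R) / 12%:R * bernoulli (p - 3)
  \in zideal p 6.
Proof.
move=> h_odd.
have [q hq] : exists q, p./2 = q.+3 by exists (p./2 - 3)%N; lia.
have h_gt1 : (1 < p./2)%N by lia.
have -> : gauss_part = gauss_term p 0 + gauss_term p p./2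
    + \sum_(1 <= k < p./2) (gauss_term p k - lead_term p k).
  rewrite sumrB sum_lead_term // subr0 /gauss_part -(big_mkord xpredT).
  by rewrite big_nat_recr //= big_ltn 1?addrAC // ltnW.
have -> : \sum_(1 <= k < p./2) (gauss_term p k - lead_term p k) =
   (gauss_term p 1 - lead_term p 1) +
   (gauss_term p p./2.-1 - lead_term p p./2.-1) +
   \sum_(2 <= k < p./2.-1) (gauss_term p k - lead_term p k).
  by rewrite big_ltn // hq big_nat_recr //= addrA addrAC.
have mid : \sum_(2 <= k < p./2.-1) (gauss_term p k - lead_term p k) \in zideal p 6.
  apply: zideal_sum => // k; rewrite mem_index_iota => k_mid.
  by apply: gauss_term_middle; lia.
have corr : p%:R ^+ 6 * ((p%:R - 1) * (p%:R - 2%:R) * bernoulli (p - 3) / 24%:R)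
    \in zideal p 6.
  apply: zidealMr; rewrite ?zidealX //; apply: zlocalM => //; last first.
    by apply: zlocal_natV => //; apply: prime_ndvd24 => //; lia.
  apply: zlocalM => //; last by apply: bernoulli_zlocal => //; lia.
  have pB k : (k <= p)%N -> p%:R - k%:R \in zlocal p.
    by move=> le_kp; rewrite -natrB // zlocal_nat.
  by apply: zlocalM => //; [apply: (pB 1) | apply: pB]; lia.
have addI x y : x \in zideal p 6 -> y \in zideal p 6 -> x + y \in zideal p 6.
  exact: zidealD.
have ends := gauss_term_ends h_odd.
have pen := gauss_term_penultimate h_odd.
have := addI _ _ (addI _ _ (addI _ _ ends gauss_term1) (addI _ _ pen mid)) corr.
set u := (u in u \in zideal p 6 -> _); set v := (v in _ -> v \in _).
by suff -> : v = u by []; rewrite /u /v; field.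
Qed.
End Expansion.

(** * Valuations of integers *)

Lemma zideal_int p k (z : int) : prime p ->
  (z%:~R \in zideal p k) = (p ^ k %| `|z|)%N.
Proof.
move=> p_prime; have pX_neq0 : p%:R ^+ k != 0 :> rat.
  by rewrite expf_neq0 // pnatr_eq0 -lt0n prime_gt0.
apply/idP/idP => [/(zlocalP _ _ p_prime)[d pNd /intrP[n zd]] | /dvdnP[c zE]].
  have /intr_inj zdE : (z * d)%:~R = (n * (p ^ k)%N%:Z)%:~R :> rat.
    by rewrite !intrM -zd -pmulrn natrX mulrAC divfK.
  rewrite -(@Gauss_dvdl _ _ `|d|); last first.
    by rewrite coprimeXl // prime_coprime.
  by rewrite -abszM zdE abszM /= dvdn_mull.
rewrite zidealE; have -> : z%:~R = (-1) ^+ (z < 0)%R * c%:R * p%:R ^+ k :> rat.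
  rewrite {1}[z]intEsign zE intrM rmorphXn /= rmorphN1.
  by rewrite PoszM intrM -!pmulrn natrX mulrA.
by rewrite mulfK // zlocalM ?zlocal_nat //; exact: sign_zlocal.
Qed.

Lemma vp_int_ge p k (z : int) : prime p ->
  ((k%:Z)%:E <= vp p z%:~R)%E = (p ^ k %| `|z|)%N.
Proof.
move=> p_prime; rewrite /vp intr_eq0 numq_int denq_int logn1 subr0.
have [-> | z_neq0] := eqVneq z 0; first by rewrite leey dvdn0.
by rewrite lee_fin lez_nat pfactor_dvdn // absz_gt0.
Qed.

Lemma vp_int_eq p k (z : int) : prime p ->
  vp p z%:~R = (k%:Z)%:E <-> (p ^ k %| `|z|)%N && ~~ (p ^ k.+1 %| `|z|)%N.
Proof.
move=> p_prime; rewrite /vp intr_eq0 numq_int denq_int logn1 subr0.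
have [-> | z_neq0] := eqVneq z 0; first by rewrite absz0 !dvdn0.
rewrite !pfactor_dvdn ?absz_gt0 // -ltnNge ltnS -eqn_leq eq_sym.
by split=> [[->] // | /eqP ->].
Qed.

Lemma vpN p x : vp p (- x) = vp p x.
Proof. by rewrite /vp oppr_eq0 numqN denqN abszN. Qed.

(** * The Gaussian power sum *)

Lemma sum_double_split (V : nmodType) (f : nat -> V) n :
  \sum_(j < n.*2) f j = \sum_(k < n) (f k.*2 + f k.*2.+1).
Proof.
by elim: n => [|n IHn]; rewrite ?big_ord0 // doubleS !big_ord_recr IHn /= addrA.
Qed.

Lemma complex_cartesian (R : realFieldType) (a b : R) :
  (a +i* b)%C = (a%:C)%C + 'i%C * (b%:C)%C.
Proof.
apply/eqP; rewrite eq_complex /=.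
by rewrite !(mul0r, mulr0, mul1r, subr0, addr0, add0r) !eqxx.
Qed.

Lemma complex_sqr_i (R : realFieldType) : 'i%C ^+ 2 = - 1 :> R[i].
Proof.
apply/eqP; rewrite expr2 eq_complex /=.
by rewrite !(mul0r, mulr0, mul1r, sub0r, addr0, oppr0) !eqxx.
Qed.

Lemma gauss_sum_binomial p : gauss_sum p p = \sum_(j < p.+1)
  'i%C ^+ j * (('C(p, j)%:R * powsum p (p - j) * powsum p j)%:C)%C.
Proof.
rewrite /gauss_sum.
under eq_bigr => a _ do under eq_bigr => b _ do
  rewrite complex_cartesian exprDn.
under eq_bigr => a _ do rewrite exchange_big.
rewrite exchange_big; apply: eq_bigr => j _ /=.
rewrite /powsum -mulrA big_distrlr mulr_sumr rmorph_sum mulr_sumr /=.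
apply: eq_bigr => a _; rewrite mulr_sumr rmorph_sum mulr_sumr /=.
apply: eq_bigr => b _.
rewrite exprMn -mulr_natl !rmorphM !rmorphXn !rmorph_nat; ring.
Qed.

(** The terms of index 2k and p - 2k of the binomial expansion carry i^(2k) =
    (-1)^k and i^(p-2k) = - i (-1)^k, the latter because (p-1)/2 is odd. *)
Lemma gauss_sumE p : odd p -> odd p./2 ->
  gauss_sum p p = (1 - 'i%C) * ((gauss_part p)%:C)%C.
Proof.
move=> p_odd h_odd.
have pE : p = p./2.*2.+1 by rewrite -[LHS]odd_double_half p_odd.
rewrite gauss_sum_binomial.
have -> : p.+1 = p./2.+1.*2 by lia.
rewrite (sum_double_split _ (fun j => 'i%C ^+ j
  * (('C(p, j)%:R * powsum p (p - j) * powsum p j)%:C)%C)).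
rewrite big_split /= [X in _ + X](reindex_inj rev_ord_inj) -big_split /=.
rewrite /gauss_part rmorph_sum mulr_sumr; apply: eq_bigr => k _ /=.
have k_le : (k <= p./2)%N by rewrite -ltnS.
have -> : (p./2.+1 - k.+1).*2.+1 = (p - k.*2)%N by lia.
have i2 m : 'i%C ^+ m.*2 = ((-1) ^+ m) :> rat[i].
  by rewrite -mul2n exprM complex_sqr_i.
have -> : 'i%C ^+ (p - k.*2) = - 'i%C * (-1) ^+ k :> rat[i].
  have -> : (p - k.*2)%N = (p./2 - k).*2.+1 by lia.
  rewrite exprS i2 -signr_odd oddB // h_odd signrN signr_odd; ring.
rewrite subKn; last lia.
rewrite bin_sub; last lia.
rewrite i2 /gauss_term !rmorphM !rmorphXn rmorphN1; ring.
Qed.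

Lemma gauss_part_int p : gauss_part p \is a Num.int.
Proof.
have powsum_int m : powsum p m \is a Num.int.
  by apply: rpred_sum => a _; rewrite rpredX // natr_int.
apply: rpred_sum => k _; rewrite /gauss_term !rpredM ?natr_int //.
by rewrite rpredX // rpredN rpred1.
Qed.

Lemma one_sub_i_mul (R : realFieldType) (x : R) :
  (1 - 'i%C) * (x%:C)%C = (x +i* - x)%C :> R[i].
Proof.
apply/eqP; rewrite eq_complex /=.
by rewrite !(mul0r, mulr0, subr0, sub0r, oppr0, addr0, add0r, mul1r, mulNr) !eqxx.
Qed.

Lemma dvd_zlocalP p k x y : prime p ->
  dvd_in (zlocal p) (p%:R ^+ k) (x - y) <-> x - y \in zideal p k.
Proof.
move=> p_prime; have pX_neq0 : p%:R ^+ k != 0 :> rat.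
  by rewrite expf_neq0 // pnatr_eq0 -lt0n prime_gt0.
split=> [[w wZ ->] | xyI]; first by rewrite mulrC zidealE mulfK.
by exists ((x - y) / p%:R ^+ k) => //; rewrite mulrC divfK.
Qed.

Theorem theorem1 (p : nat) (p_prime : prime p) (p_ge7 : (7 <= p)%N)
    (p_mod4 : p = 3 %[mod 4]) :
  [/\ eqmod_in (adjoin_i (zlocal p)) (p%:R ^+ 6)
        (gauss_sum p p)
        (- (p%:R ^+ 5 / 12%:R) * (p%:R - 1) ^+ 2 * (p%:R - 2%:R)
           * (1 - 'i%C) * ((bernoulli (p - 3))%:C)%C),
      dvd_in (adjoin_i integers) ((1 - 'i%C) * p%:R ^+ 5) (gauss_sum p p),
      ~~ (p%:Z %| denq (bernoulli (p - 3)))%Z,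
      ((6%:Z)%:E <= vpi p (gauss_sum p p))%E <->
        eqmod_in (zlocal p) p%:R (bernoulli (p - 3)) 0
    & vpi p (gauss_sum p p) = (5%:Z)%:E <->
        ~ eqmod_in (zlocal p) p%:R (bernoulli (p - 3)) 0].
Proof.
have p_odd : odd p by lia.
have h_odd : odd p./2 by lia.
have p_neq0 : p%:R != 0 :> rat by rewrite pnatr_eq0; lia.
have p5_neq0 : p%:R ^+ 5 != 0 :> rat by rewrite expf_neq0.
have p6_neq0 : p%:R ^+ 6 != 0 :> rat by rewrite expf_neq0.
pose B := bernoulli (p - 3); have BZ : B \in zlocal p.
  by apply: bernoulli_zlocal => //; lia.
(* The coefficient c is a unit of Z_(p): the prime p >= 7 divides neither 12
   nor (p - 1)^2 (p - 2). *)
pose c : rat := (p%:R - 1) ^+ 2 * (p%:R - 2%:R) / 12%:R.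
pose M : rat := - (p%:R ^+ 5 * c * B).
have [z TE] : exists z : int, gauss_part p = z%:~R by apply/intrP/gauss_part_int.
have GE : gauss_sum p p = (z%:~R +i* - z%:~R)%C.
  by rewrite gauss_sumE // TE one_sub_i_mul.
have p1E : p%:R - 1 = (p - 1)%:R :> rat by rewrite natrB //; lia.
have p2E : p%:R - 2%:R = (p - 2)%:R :> rat by rewrite natrB //; lia.
have nd24 : ~~ (p %| 24)%N by apply: prime_ndvd24 => //; lia.
have nd12 : ~~ (p %| 12)%N by apply: contra nd24 => /dvdn_mulr -/(_ 2).
have cZ : c \in zlocal p.
  rewrite /c p1E p2E -natrX -natrM.
  by apply: zlocalM; [| exact: zlocal_nat | exact: zlocal_natV].
have cVZ : c^-1 \in zlocal p.
  rewrite /c p1E p2E -natrX -natrM invfM invrK.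
  apply: zlocalM => //; last exact: zlocal_nat.
  apply: zlocal_natV => //; rewrite Euclid_dvdM // Euclid_dvdX //.
  by rewrite !gtnNdvd //; lia.
have c_neq0 : c != 0.
  rewrite /c p1E p2E !mulf_neq0 ?invr_eq0 ?expf_neq0 ?pnatr_eq0 //; lia.
have T_mod6 : z%:~R - M \in zideal p 6.
  have := gauss_part_mod6 p p_prime p_ge7 p_odd h_odd.
  rewrite TE /M opprK.
  by have -> : p%:R ^+ 5 * (p%:R - 1) ^+ 2 * (p%:R - 2%:R) / 12%:R
    * bernoulli (p - 3) = p%:R ^+ 5 * c * B by rewrite /c /B; field.
have MI : M \in zideal p 5.
  apply: zidealN; rewrite -mulrA; apply: zidealMr; rewrite ?zidealX //.
  exact: zlocalM.
have zI5 : z%:~R \in zideal p 5.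
  rewrite -(subrK M z%:~R); apply: zidealD => //.
  exact: zideal_le T_mod6.
have z_dvd5 : (p ^ 5 %| `|z|)%N by rewrite -zideal_int.
(* As z = M = - p^5 c B modulo p^6 and c is a unit, p^6 divides z exactly when
   p divides B. *)
have z_dvd6 : (p ^ 6 %| `|z|)%N <-> eqmod_in (zlocal p) p%:R B 0.
  rewrite -zideal_int //.
  have -> : eqmod_in (zlocal p) p%:R B 0 <-> B \in zideal p 1.
    rewrite -{2}[B]subr0 -dvd_zlocalP // expr1.
    by split=> [[] // | dvdB]; split; rewrite ?(zlocal_nat _ 0).
  have -> : (z%:~R \in zideal p 6) = (M \in zideal p 6).
    apply/idP/idP => [zI | MI6].
      have -> : M = z%:~R - (z%:~R - M) by rewrite subKr.
      by apply: zidealD => //; apply: zidealN.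
    by rewrite -(subrK M z%:~R); apply: zidealD.
  have -> : M = p%:R ^+ 5 * (- c * B) by rewrite /M; ring.
  rewrite !zidealE.
  have -> : p%:R ^+ 5 * (- c * B) / p%:R ^+ 6 = - c * (B / p%:R ^+ 1) by field.
  split=> [cB | ]; last by apply: zlocalM => //; apply: zlocalN.
  have -> : B / p%:R ^+ 1 = - (c^-1 * (- c * (B / p%:R ^+ 1))).
    by field; rewrite p_neq0.
  by apply: zlocalN; apply: zlocalM.
have vE : vpi p (gauss_sum p p) = vp p z%:~R.
  by rewrite /vpi GE /= vpN minxx.
have MIE : - (p%:R ^+ 5 / 12%:R) * (p%:R - 1) ^+ 2 * (p%:R - 2%:R)
           * (1 - 'i%C) * (B%:C)%C = (M +i* - M)%C :> rat[i].
  rewrite -one_sub_i_mul /M /c.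
  rewrite !(rmorphN, rmorphM, rmorphXn, rmorphB, rmorph_nat, fmorphV, rmorph1) /=.
  by field.
have adjZ x : x \in zlocal p -> (x +i* - x)%C \in adjoin_i (zlocal p).
  by move=> xZ; rewrite inE /= xZ zlocalN.
split => //.
- rewrite MIE GE; split.
  + by apply: adjZ; rewrite -zideal0E; apply: zideal_le zI5.
  + by apply: adjZ; rewrite -zideal0E; apply: zideal_le MI.
  exists (((z%:~R - M) / p%:R ^+ 6) +i* - ((z%:~R - M) / p%:R ^+ 6))%C.
    exact: adjZ T_mod6.
  rewrite -!one_sub_i_mul -mulrBr mulrCA -rmorphB /=; congr (_ * _).
  rewrite -[in LHS](divfK p6_neq0 (z%:~R - M)) mulrC.
  by rewrite rmorphM rmorphXn rmorph_nat.
- exists ((z%:~R / p%:R ^+ 5)%:C)%C.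
    rewrite inE /= inE rpred0 andbT.
    case/dvdnP: z_dvd5 => q zE.
    rewrite [z]intEsign zE intrM -[(q * _)%N%:~R]pmulrn natrM natrX.
    by rewrite mulrA mulfK // rpredM ?natr_int ?intr_int.
  rewrite GE -one_sub_i_mul -mulrA; congr (_ * _).
  rewrite -[in LHS](divfK p5_neq0 z%:~R) mulrC.
  by rewrite rmorphM rmorphXn rmorph_nat.
- by rewrite vE vp_int_ge.
rewrite vE vp_int_eq // z_dvd5 /= -z_dvd6.
by split=> /negP.
Qed.
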